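(* Collisions in the reduced two-body system happen in finite time: if $(m_1,m_2,m_3,q,p):[0,t^* )\to\mathbb{R}^3\times(0,\pi)\times\mathbb{R}$, with $t^*\in(0,+\infty]$, is a solution such that $q(t)\to0$ as $t\to t^*$, then $t^*<+\infty$.
   Context: The reduced two-body system on $S^2$ (two identical bodies of mass $1$, potential $V(q)=-\cot q$, where $q\in(0,\pi)$ is the angle between the position vectors $\mathbf{q}_1,\mathbf{q}_2$, so that $q\to 0$ means $\mathbf{q}_1-\mathbf{q}_2\to0$) is the following system of ODEs for $(m_1,m_2,m_3,q,p)\in\mathbb{R}^3\times(0,\pi)\times\mathbb{R}$: $$\dot m_1=\cot(q)\,(-m_2^2+m_3^2+2m_2m_3\cot q),\quad \dot m_2=m_1m_2\cot q-m_3(-2m_1+p+2m_1\csc^2 q),\quad \dot m_3=m_2p-m_1m_3\cot q,$$ $$\dot q=2p-m_1,\qquad \dot p=-\csc^2(q)\,(1+m_2m_3-2m_3^2\cot q).$$ It has the conserved quantities $\mathcal{C}=m_1^2+m_2^2+m_3^2$ (the Casimir function) and, with $\xi=\cot q$, $\mathcal{H}=\frac12\left(m_1^2+m_2^2-2m_1p+2p^2+\xi(-2-2m_2m_3+m_3^2\xi)+m_3^2(1+\xi^2)\right)$ (the Hamiltonian). *)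

(* Defs.v *)
From Stdlib Require Import Reals.
From Coquelicot Require Import Coquelicot.
Open Scope R_scope.

Definition cot (x : R) : R := cos x / sin x.
Definition csc (x : R) : R := / sin x.

Definition m1_dot (m1 m2 m3 q p : R) : R :=
  cot q * (- m2 ^ 2 + m3 ^ 2 + 2 * m2 * m3 * cot q).

Definition m2_dot (m1 m2 m3 q p : R) : R :=
  m1 * m2 * cot q - m3 * (- 2 * m1 + p + 2 * m1 * csc q ^ 2).

Definition m3_dot (m1 m2 m3 q p : R) : R :=
  m2 * p - m1 * m3 * cot q.

Definition q_dot (m1 m2 m3 q p : R) : R :=
  2 * p - m1.

Definition p_dot (m1 m2 m3 q p : R) : R :=
  - csc q ^ 2 * (1 + m2 * m3 - 2 * m3 ^ 2 * cot q).

(* The interval [0, tstar), where tstar may be infinite. *)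
Definition time_domain (tstar : Rbar) (t : R) : Prop :=
  0 <= t /\ Rbar_lt t tstar.

(* [D_in f f' I t] is differentiability relative to I: the ordinary
   derivative for 0 < t < tstar and the right derivative at t = 0, so the
   values of the five functions outside [0, tstar) play no role. *)
Definition is_solution (tstar : Rbar) (m1 m2 m3 q p : R -> R) : Prop :=
  let I := time_domain tstar in
  let along (F : R -> R -> R -> R -> R -> R) (s : R) :=
    F (m1 s) (m2 s) (m3 s) (q s) (p s) in
  forall t : R, I t ->
    0 < q t < PI /\
    D_in m1 (along m1_dot) I t /\
    D_in m2 (along m2_dot) I t /\
    D_in m3 (along m3_dot) I t /\
    D_in q (along q_dot) I t /\
    D_in p (along p_dot) I t.

(* f(t) -> l as t -> tstar with t in [0, tstar): a left limit if tstar is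
   finite, a limit at +oo otherwise. *)
Definition tends_at_end (tstar : Rbar) (f : R -> R) (l : R) : Prop :=
  filterlim f (within (time_domain tstar) (Rbar_locally tstar)) (locally l).

(* Main.v *)
(* A Lagrange-Jacobi argument.  Eliminating the kinetic energy with H and using
   the Casimir C, the virial quantity (1 - cos q)' = sin q * q' satisfies
     (1 - cos q)'' = 2 cos^2 q / sin q - 2 sin q + (4 H - C) cos q
                     + 2 m3^2 cos q - 2 m2 m3 sin q,
   where every term but the first is bounded below, since H and C are constant.
   If q -> 0 as t -> +oo, then eventually (1 - cos q)'' >= 1, so 1 - cos q would
   be unbounded. *)
Require Import Defs.
From Stdlib Require Import Reals Lra.
From Coquelicot Require Import Coquelicot.
Open Scope R_scope.

Definition casimir (m1 m2 m3 : R) : R := m1 ^ 2 + m2 ^ 2 + m3 ^ 2.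

Definition hamiltonian (m1 m2 m3 q p : R) : R :=
  / 2 * (m1 ^ 2 + m2 ^ 2 - 2 * m1 * p + 2 * p ^ 2
         + cot q * (- 2 - 2 * m2 * m3 + m3 ^ 2 * cot q)
         + m3 ^ 2 * (1 + cot q ^ 2)).

(** * Differential calculus on a half-line *)

Lemma D_in_is_derive (f f' : R -> R) (D : R -> Prop) (t : R) :
  locally t D -> D_in f f' D t -> is_derive f t (f' t).
Proof.
intros [d hd] h; apply is_derive_Reals; intros eps heps.
destruct (h eps heps) as [a [ha hlim]].
assert (hm : 0 < Rmin a d) by (apply Rmin_pos; [exact ha | apply cond_pos]).
exists (mkposreal _ hm); intros u hu hlt; simpl in hlt.
assert (hua := Rlt_le_trans _ _ _ hlt (Rmin_l a d)).
assert (hud := Rlt_le_trans _ _ _ hlt (Rmin_r a d)).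
specialize (hlim (t + u)); simpl in hlim; unfold Rdist in hlim.
replace (t + u - t) with u in hlim by ring.
apply hlim; split; [split | exact hua].
- apply hd; unfold ball; simpl; unfold AbsRing_ball, abs, minus, plus, opp; simpl.
  now replace (t + u + - t) with u by ring.
- lra.
Qed.

Lemma derive_ge_growth (f f' : R -> R) (a b k : R) :
  a <= b -> (forall t, a <= t -> is_derive f t (f' t)) ->
  (forall t, a <= t -> k <= f' t) -> f a + k * (b - a) <= f b.
Proof.
intros hab hd hk.
assert (hin : forall t, Rmin a b <= t -> a <= t)
  by (rewrite Rmin_left; [intros; assumption | exact hab]).
destruct (MVT_gen f a b f') as [c [[hc _] e]].
- intros t ht; apply hd, hin; lra.
- intros t ht; apply derivable_continuous_pt, ex_derive_Reals_0.
  exists (f' t); apply hd, hin; lra.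
- assert (h := Rmult_le_compat_r (b - a) _ _ ltac:(lra) (hk c (hin c hc))); lra.
Qed.

Lemma derive_zero_const (f : R -> R) (a b : R) :
  a <= b -> (forall t, a <= t -> is_derive f t 0) -> f b = f a.
Proof.
intros hab hd.
assert (h1 := derive_ge_growth f (fun _ => 0) a b 0 hab hd ltac:(intros; lra)).
(* Growth at rate 0 only gives [f a <= f b]; the reverse inequality comes from applying it to
   [- f]. *)
assert (hn : forall t, a <= t -> is_derive (fun s : R => - f s) t 0).
{ intros t ht; rewrite <- Ropp_0; now apply (is_derive_opp f t 0), hd. }
assert (h2 := derive_ge_growth _ (fun _ => 0) a b 0 hab hn ltac:(intros; lra)).
simpl in h2; lra.
Qed.

(** * Cotangent calculus and the virial estimate *)

Lemma csc_sqr (q : R) : sin q <> 0 -> csc q ^ 2 = 1 + cot q ^ 2.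
Proof.
intros hs; unfold csc, cot.
assert (h := sin2_cos2 q); unfold Rsqr in h.
apply (Rmult_eq_reg_r (sin q * sin q)); [| now apply Rmult_integral_contrapositive].
transitivity 1; [now field | rewrite <- h at 1; now field].
Qed.

Lemma is_derive_cot (q : R) : sin q <> 0 -> is_derive cot q (- csc q ^ 2).
Proof.
intros hs; unfold cot, csc.
auto_derive; [exact hs |].
assert (h := sin2_cos2 q); unfold Rsqr in h.
transitivity (- (sin q * sin q + cos q * cos q) / sin q ^ 2); [now field |].
rewrite h; now field.
Qed.

Lemma cot_comp_derive (q : R -> R) (t dq : R) :
  sin (q t) <> 0 -> is_derive q t dq ->
  is_derive (fun s : R => cot (q s)) t (- (1 + cot (q t) ^ 2) * dq).
Proof.
intros hs hq; rewrite <- csc_sqr by exact hs.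
rewrite Rmult_comm; apply (is_derive_comp cot q); [now apply is_derive_cot | exact hq].
Qed.

(** The left side is the second time derivative of [1 - cos q]. With [cos q = sin q * cot q] and
    [csc q ^ 2 = 1 + cot q ^ 2], both sides become polynomials in [sin q], [cot q] and the other
    variables. *)
Lemma virial_identity (m1 m2 m3 q p : R) : sin q <> 0 ->
  cos q * q_dot m1 m2 m3 q p ^ 2
    + sin q * (2 * p_dot m1 m2 m3 q p - m1_dot m1 m2 m3 q p)
  = 2 * cos q ^ 2 / sin q - 2 * sin q
    + (4 * hamiltonian m1 m2 m3 q p - casimir m1 m2 m3) * cos q
    + 2 * m3 ^ 2 * cos q - 2 * m2 * m3 * sin q.
Proof.
intros hs.
assert (hc : cos q = sin q * cot q) by (unfold cot; field; exact hs).
assert (hk : 2 * cos q ^ 2 / sin q = 2 * sin q * cot q ^ 2)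
  by (rewrite hc; field; exact hs).
rewrite hk, hc; unfold q_dot, p_dot, m1_dot, hamiltonian, casimir.
rewrite csc_sqr by exact hs; field.
Qed.

(** In the identity, [- 2 * sin q] costs at most 2, the energy term [4 * |H|], and the Casimir and
    [m2 * m3] terms [C] each. The 3 in the smallness condition is this 2 plus the 1 to be kept. *)
Lemma virial_lower_bound (m1 m2 m3 q p : R) :
  0 < q -> q <= 1 ->
  2 * q * (3 + 4 * Rabs (hamiltonian m1 m2 m3 q p) + 2 * casimir m1 m2 m3) <= 1 ->
  1 <= cos q * q_dot m1 m2 m3 q p ^ 2
       + sin q * (2 * p_dot m1 m2 m3 q p - m1_dot m1 m2 m3 q p).
Proof.
intros hq0 hq1 hq.
assert (hpi := PI2_3_2).
assert (hs : 0 < sin q) by (apply sin_gt_0; lra).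
assert (hsq : sin q < q) by (apply sin_lt_x; lra).
assert (hs1 := SIN_bound q); assert (hc1 := COS_bound q).
(* By [hpi], [q <= 1 < PI / 3], and cosine decreases there. *)
assert (hc : / 2 <= cos q).
{ replace (/ 2) with (cos (PI / 3)) by (rewrite cos_PI3; field).
  apply cos_decr_1; lra. }
rewrite virial_identity by lra.
revert hq; generalize (hamiltonian m1 m2 m3 q p); intros h hq.
assert (hC : 0 <= casimir m1 m2 m3) by (unfold casimir; nra).
assert (hm : 2 * m2 * m3 * sin q <= casimir m1 m2 m3).
(* AM-GM, followed by [0 < sin q <= 1] and [C >= 0]. *)
{ assert (2 * (m2 * m3) <= casimir m1 m2 m3)
    by (unfold casimir; assert (0 <= (m2 - m3) ^ 2) by apply pow2_ge_0; nra).
  nra. }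
assert (hm3 : 0 <= 2 * m3 ^ 2 * cos q) by (assert (0 <= m3 ^ 2) by apply pow2_ge_0; nra).
assert (hh : - (4 * Rabs h) <= 4 * h * cos q).
{ assert (h1 := Rabs_maj2 h); assert (h2 := Rabs_pos h); nra. }
set (K := 3 + 4 * Rabs h + 2 * casimir m1 m2 m3) in *.
assert (hK : 0 < K) by (unfold K; assert (h2 := Rabs_pos h); lra).
(* [K * sin q <= K * q <= 1/2 <= 2 * cos q ^ 2]. *)
assert (hmain : K <= 2 * cos q ^ 2 / sin q).
{ apply (Rmult_le_reg_r (sin q)); [exact hs |].
  replace (2 * cos q ^ 2 / sin q * sin q) with (2 * cos q ^ 2) by (field; lra).
  nra. }
unfold K in hmain; nra.
Qed.

(** * Solutions existing for all time *)

Section Solution.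

Variables m1 m2 m3 q p : R -> R.
Hypothesis hsol : is_solution p_infty m1 m2 m3 q p.

(** Strict positivity of [t] turns the relative derivatives into two-sided ones; at 0 only right
    derivatives are given. *)
Lemma solution_derivatives (t : R) : 0 < t ->
  let at_t (F : R -> R -> R -> R -> R -> R) := F (m1 t) (m2 t) (m3 t) (q t) (p t) in
  0 < sin (q t) /\
  is_derive m1 t (at_t m1_dot) /\ is_derive m2 t (at_t m2_dot) /\
  is_derive m3 t (at_t m3_dot) /\ is_derive q t (at_t q_dot) /\
  is_derive p t (at_t p_dot).
Proof.
intros ht at_t.
assert (hI : locally t (time_domain p_infty)).
{ apply (filter_imp (fun s : R => 0 < s)).
  - intros s hs; split; [lra | exact I].
  - now apply open_gt. }
destruct (hsol t (conj (Rlt_le _ _ ht) I)) as [hq [h1 [h2 [h3 [h4 h5]]]]].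
split; [now apply sin_gt_0 |].
exact (conj (D_in_is_derive _ _ _ _ hI h1)
        (conj (D_in_is_derive _ _ _ _ hI h2)
        (conj (D_in_is_derive _ _ _ _ hI h3)
        (conj (D_in_is_derive _ _ _ _ hI h4) (D_in_is_derive _ _ _ _ hI h5))))).
Qed.

Lemma casimir_constant (a b : R) : 0 < a <= b ->
  casimir (m1 b) (m2 b) (m3 b) = casimir (m1 a) (m2 a) (m3 a).
Proof.
intros [ha hab].
apply (derive_zero_const (fun s : R => casimir (m1 s) (m2 s) (m3 s))); [exact hab |].
intros t ht.
destruct (solution_derivatives t) as [hs [h1 [h2 [h3 _]]]]; [lra |].
unfold casimir; auto_derive.
- repeat split; eexists; eassumption.
- rewrite (is_derive_unique (fun s : R => m1 s) _ _ h1),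
    (is_derive_unique (fun s : R => m2 s) _ _ h2),
    (is_derive_unique (fun s : R => m3 s) _ _ h3).
  unfold m1_dot, m2_dot, m3_dot; rewrite csc_sqr by lra; ring.
Qed.

Lemma hamiltonian_constant (a b : R) : 0 < a <= b ->
  hamiltonian (m1 b) (m2 b) (m3 b) (q b) (p b)
  = hamiltonian (m1 a) (m2 a) (m3 a) (q a) (p a).
Proof.
intros [ha hab].
apply (derive_zero_const (fun s : R => hamiltonian (m1 s) (m2 s) (m3 s) (q s) (p s)));
  [exact hab |].
intros t ht.
destruct (solution_derivatives t) as [hs [h1 [h2 [h3 [h4 h5]]]]]; [lra |].
assert (hx := cot_comp_derive q t _ ltac:(lra) h4).
unfold hamiltonian.
(* With [cot (q s)] kept as an opaque function whose derivative is [hx], the Hamiltonian is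
   polynomial, and its derivative cancels algebraically. *)
set (x := fun s => cot (q s)) in hx.
apply (is_derive_ext (fun s : R => / 2 * (m1 s ^ 2 + m2 s ^ 2 - 2 * m1 s * p s + 2 * p s ^ 2
         + x s * (- 2 - 2 * m2 s * m3 s + m3 s ^ 2 * x s)
         + m3 s ^ 2 * (1 + x s ^ 2)))); [reflexivity |].
auto_derive.
- repeat split; eexists; eassumption.
- rewrite (is_derive_unique (fun s : R => m1 s) _ _ h1),
    (is_derive_unique (fun s : R => m2 s) _ _ h2),
    (is_derive_unique (fun s : R => m3 s) _ _ h3), (is_derive_unique (fun s : R => p s) _ _ h5),
    (is_derive_unique (fun s : R => x s) _ _ hx).
  unfold x, m1_dot, m2_dot, m3_dot, q_dot, p_dot; rewrite csc_sqr by lra; field.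
Qed.

Lemma virial_derivative (t : R) : 0 < t ->
  is_derive (fun s : R => sin (q s) * (2 * p s - m1 s)) t
    (cos (q t) * q_dot (m1 t) (m2 t) (m3 t) (q t) (p t) ^ 2
     + sin (q t) * (2 * p_dot (m1 t) (m2 t) (m3 t) (q t) (p t)
                    - m1_dot (m1 t) (m2 t) (m3 t) (q t) (p t))).
Proof.
intros ht.
destruct (solution_derivatives t ht) as [hs [h1 [_ [_ [h4 h5]]]]].
auto_derive.
- repeat split; eexists; eassumption.
- rewrite (is_derive_unique (fun s : R => m1 s) _ _ h1),
    (is_derive_unique (fun s : R => q s) _ _ h4),
    (is_derive_unique (fun s : R => p s) _ _ h5).
  unfold q_dot; ring.
Qed.

Lemma neg_cos_derivative (t : R) : 0 < t ->
  is_derive (fun s : R => - cos (q s)) t (sin (q t) * (2 * p t - m1 t)).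
Proof.
intros ht.
destruct (solution_derivatives t ht) as [_ [_ [_ [_ [h4 _]]]]].
auto_derive.
- repeat split; eexists; eassumption.
- rewrite (is_derive_unique (fun s : R => q s) _ _ h4); unfold q_dot; ring.
Qed.

Lemma no_collision_at_infinity : ~ tends_at_end p_infty q 0.
Proof.
intros hcoll.
(* The invariants are sampled at time 1, where two-sided derivatives are available. *)
set (K := 3 + 4 * Rabs (hamiltonian (m1 1) (m2 1) (m3 1) (q 1) (p 1))
          + 2 * casimir (m1 1) (m2 1) (m3 1)).
assert (hK : 3 <= K).
{ unfold K, casimir.
  assert (h := Rabs_pos (hamiltonian (m1 1) (m2 1) (m3 1) (q 1) (p 1))); nra. }
(* Within radius [1 / (2K)] of 0, [q] satisfies [2 * q * K <= 1], and also [q <= 1] since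
   [K >= 3]. *)
assert (hd : 0 < / (2 * K)) by (apply Rinv_0_lt_compat; lra).
destruct (hcoll _ (locally_ball 0 (mkposreal _ hd))) as [M hM].
(* The [+ 1] makes [a] strictly larger than [M], as the neighbourhood of +oo requires. *)
set (a := Rmax 1 (M + 1)).
assert (ha1 : 1 <= a) by apply Rmax_l.
assert (haM : M + 1 <= a) by apply Rmax_r.
assert (hvir : forall t, a <= t -> 1 <=
    cos (q t) * q_dot (m1 t) (m2 t) (m3 t) (q t) (p t) ^ 2
    + sin (q t) * (2 * p_dot (m1 t) (m2 t) (m3 t) (q t) (p t)
                   - m1_dot (m1 t) (m2 t) (m3 t) (q t) (p t))).
{ intros t ht.
  assert (hI : time_domain p_infty t) by (split; [lra | exact I]).
  destruct (hsol t hI) as [hq _].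
  assert (hball := hM t ltac:(lra) hI).
  unfold ball in hball; simpl in hball.
  unfold AbsRing_ball, abs, minus, plus, opp in hball; simpl in hball.
  apply Rabs_lt_between in hball.
  assert (hqK : 2 * q t * K <= 1).
  { assert (e : / (2 * K) * (2 * K) = 1) by (field; lra); nra. }
  apply virial_lower_bound; [lra | nra |].
  rewrite (casimir_constant 1 t), (hamiltonian_constant 1 t) by lra.
  exact hqK. }
(* [y] is the derivative of [- cos q], and [hvir] bounds its own derivative below by 1. *)
set (y := fun s => sin (q s) * (2 * p s - m1 s)).
assert (hy : forall t, a <= t -> y a + 1 * (t - a) <= y t).
{ intros t ht; eapply (derive_ge_growth y); [exact ht | | exact hvir].
  intros s hs; apply virial_derivative; lra. }
(* From [b] on, [y t >= y a + |y a| + 1 >= 1]. *)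
set (b := a + Rabs (y a) + 1).
assert (habs := Rabs_maj2 (y a)); assert (habs0 := Rabs_pos (y a)).
(* Over a time span of 3, [- cos q] would rise by at least 3, but its range has length 2. *)
assert (hg : - cos (q b) + 1 * (b + 3 - b) <= - cos (q (b + 3))).
{ apply (derive_ge_growth (fun s : R => - cos (q s)) y); [lra | |].
  - intros t ht; apply neg_cos_derivative; unfold b in ht; lra.
  - intros t ht; unfold b in ht; specialize (hy t ltac:(lra)); lra. }
assert (h1 := COS_bound (q b)); assert (h2 := COS_bound (q (b + 3))); lra.
Qed.

End Solution.

Theorem lemma3p10 (tstar : Rbar) (m1 m2 m3 q p : R -> R)
  (htstar : Rbar_lt 0 tstar)
  (hsol : is_solution tstar m1 m2 m3 q p)
  (hcoll : tends_at_end tstar q 0) :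
  Rbar_lt tstar p_infty.
Proof.
(* Only [tstar = p_infty] has content: in the other cases the goal reduces to [True]. *)
destruct tstar as [r | |]; [exact I | | exact I].
exact (False_ind _ (no_collision_at_infinity _ _ _ _ _ hsol hcoll)).
Qed.
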